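(* Let $X$ be an oriented anti-Pasch Steiner loop. Then associativity (the equation $x(yz)=(xy)z$) propagates in $X$ if and only if $X$ has exponent $4$.
   Context: Associativity propagates in a loop $X$ if for all $x,y,z\in X$ with $x(yz)=(xy)z$, the identity $u(vw)=(uv)w$ holds for all $u,v,w$ in the subloop of $X$ generated by $x,y,z$. A Steiner triple system on a finite set $S$ is a set of $3$-element subsets of $S$ (blocks) such that any two distinct points lie in exactly one block. It is anti-Pasch if it contains no Pasch configuration, i.e., no four blocks of the form $\{a,b,c\},\{a,d,g\},\{h,b,g\},\{h,d,c\}$ on six distinct points $a,b,c,d,g,h$. The associated Steiner loop is $L=S\cup\{e\}$ with identity element $e$, $xx=e$ for all $x$, and, for $x\neq y$ in $S$, $xy$ equal to the third point of the block containing $x$ and $y$. The triple system is oriented if each of its blocks is given a cyclic order. For $x\ne y$ in $S$ put $d(x,y)=0\in\mathbb Z_2$ if $(x,y,xy)$ is the given cyclic order of the block $\{x,y,xy\}$, and $d(x,y)=1$ otherwise. An oriented Steiner loop arising from this oriented system is $X=\mathrm{Ext}(\mathbb Z_2,L,f)$, i.e., the set $\mathbb Z_2\times L$ with multiplication $(a,x)*(b,y)=(a+b+f(x,y),xy)$ and identity $(0,e)$, where $f\colon L\times L\to\mathbb Z_2$ satisfies $f(x,e)=f(e,x)=0$ for all $x\in L$, $f(x,y)=d(x,y)$ for $x\neq y$ in $S$, and $f(x,x)$ takes the same value for all $x\in S$. If that common value is $0$, every element of $X$ squares to the identity and $X$ has exponent $2$; if it is $1$, then $(a,x)^4=(0,e)$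 for every element regardless of parenthesization, and $X$ has exponent $4$. $X$ is called an oriented anti-Pasch Steiner loop if the underlying Steiner triple system is anti-Pasch.
   Formalization: The Steiner triple system is assumed to have at least two points (so at least one block); with a single point and f(x,x)=0, X is the group Z_2 x Z_2, where associativity propagates although X has exponent 2. *)

(* Defs.v *)
From HB Require Import structures.
From mathcomp Require Import all_boot all_order all_algebra.

Set Implicit Arguments.
Unset Strict Implicit.
Unset Printing Implicit Defensive.

Import GRing.Theory.
Local Open Scope ring_scope.

Section Loops.

Variables (T : Type) (mul : T -> T -> T) (e : T).

Definition is_loop : Prop :=
  [/\ left_id e mul, right_id e mul,
      forall a b, exists! x, mul a x = b
    & forall a b, exists! y, mul y a = b].

(* The last two clauses are closure under left and right division, written
   without naming the division operations. *)
Definition is_subloop (H : T -> Prop) : Prop :=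
  [/\ H e,
      forall x y, H x -> H y -> H (mul x y),
      forall x y, H x -> H (mul x y) -> H y
    & forall x y, H y -> H (mul x y) -> H x].

Definition subloop_generated3 (x y z u : T) : Prop :=
  forall H : T -> Prop, is_subloop H -> H x -> H y -> H z -> H u.

Definition associativity_propagates : Prop :=
  forall x y z, mul x (mul y z) = mul (mul x y) z ->
  forall u v w,
    subloop_generated3 x y z u ->
    subloop_generated3 x y z v ->
    subloop_generated3 x y z w ->
    mul u (mul v w) = mul (mul u v) w.

(* [is_power x n y]: y is the value of some parenthesization of the product of
   n copies of x. *)
Inductive is_power (x : T) : nat -> T -> Prop :=
| is_power1 : is_power x 1 x
| is_powerM m n u v :
    is_power x m u -> is_power x n v -> is_power x (m + n)%N (mul u v).

Definition exponent_divides (n : nat) : Prop :=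
  forall x y, is_power x n y -> y = e.

Definition has_exponent (n : nat) : Prop :=
  [/\ (0 < n)%N, exponent_divides n
    & forall m, (0 < m < n)%N -> ~ exponent_divides m].

End Loops.

Definition ext_mul (A : zmodType) (L : Type) (mulL : L -> L -> L)
    (f : L -> L -> A) (p q : A * L) : A * L :=
  (p.1 + q.1 + f p.2 q.2, mulL p.2 q.2).

(* Only the values of r on triples from A matter. *)
Definition is_cyclic_order (S : finType) (A : {set S})
    (r : S -> S -> S -> bool) : Prop :=
  [/\ {in A & A & A, forall x y z, r x y z -> r y z x},
      {in A & A & A, forall x y z, r x y z -> ~~ r z y x},
      forall x y z t, x \in A -> y \in A -> z \in A -> t \in A ->
        r x y z -> r x z t -> r x y t
    & {in A & A & A, forall x y z, uniq [:: x; y; z] -> r x y z || r z y x}].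

Section SteinerTripleSystems.

Variables (S : finType) (B : {set {set S}}).

Definition steiner_triple_system : Prop :=
  (forall b, b \in B -> #|b| = 3%N) /\
  (forall x y, x != y -> exists! b, [/\ b \in B, x \in b & y \in b]).

Definition anti_pasch : Prop :=
  ~ exists a b c d g h : S,
      [/\ uniq [:: a; b; c; d; g; h],
          [set a; b; c] \in B, [set a; d; g] \in B,
          [set h; b; g] \in B & [set h; d; c] \in B].

(* For x != y in a Steiner triple system the block exists, so the default x is
   never returned. *)
Definition third_point (x y : S) : S :=
  odflt x [pick z | [set x; y; z] \in B].

(* The Steiner loop lives on [option S], with [None] as its identity. *)
Definition steiner_mul (x y : option S) : option S :=
  match x, y with
  | None, _ => y
  | _, None => x
  | Some s, Some t => if s == t then None else Some (third_point s t)
  end.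

(* [o b] is the cyclic order given to the block b. *)
Definition is_orientation (o : {set S} -> S -> S -> S -> bool) : Prop :=
  forall b, b \in B -> is_cyclic_order b (o b).

Definition orientation_sign (o : {set S} -> S -> S -> S -> bool)
    (x y : S) : 'Z_2 :=
  let z := third_point x y in if o [set x; y; z] x y z then 0 else 1.

Definition is_oriented_factor (o : {set S} -> S -> S -> S -> bool)
    (f : option S -> option S -> 'Z_2) : Prop :=
  [/\ forall x, f x None = 0,
      forall x, f None x = 0,
      forall x y : S, x != y -> f (Some x) (Some y) = orientation_sign o x y
    & forall x y : S, f (Some x) (Some x) = f (Some y) (Some y)].

Definition oriented_steiner_mul (f : option S -> option S -> 'Z_2) :
    'Z_2 * option S -> 'Z_2 * option S -> 'Z_2 * option S :=
  ext_mul steiner_mul f.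

Definition oriented_steiner_one : 'Z_2 * option S := (0, None).

Lemma third_pointP : steiner_triple_system -> forall x y z, x != y ->
  (third_point x y == z) = ([set x; y; z] \in B).
Proof.
move=> [card3 sts] x y z xy.
have [b [[bB xb yb] buniq]] := sts x y xy.
have third_neq t : [set x; y; t] \in B -> (t != x) && (t != y).
  move=> /card3 h; apply/andP; split; apply/eqP => tE; move: h; rewrite tE.
  - by rewrite setUC setUA setUid cards2; case: (x != y).
  - by rewrite -setUA setUid cards2; case: (x != y).
have uniqT t u : [set x; y; t] \in B -> [set x; y; u] \in B -> t = u.
  move=> tB uB; have /andP[tx ty] := third_neq t tB.
  have eq_b v : [set x; y; v] \in B -> b = [set x; y; v].
    by move=> vB; apply: buniq; split; rewrite // !inE eqxx ?orbT.
  have := eq_b u uB; rewrite (eq_b t tB) => /setP/(_ t).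
  by rewrite !inE eqxx !orbT (negbTE tx) (negbTE ty) /= => /esym/eqP.
have [t tB] : exists t, [set x; y; t] \in B.
  have /card_gt0P[t] : (0 < #|b :\: [set x; y]|)%N.
    rewrite cardsD (setIidPr _) ?cards2 ?xy ?(card3 b bB) //.
    by apply/subsetP=> u; rewrite !inE => /orP[] /eqP->.
  rewrite !inE negb_or => /andP[/andP[tx ty] tb].
  exists t; suff -> : [set x; y; t] = b by [].
  apply/eqP; rewrite eqEcard card3 //; apply/andP; split.
    by apply/subsetP=> u; rewrite !inE => /orP[/orP[]|] /eqP->.
  by rewrite setUC cardsU1 !inE negb_or tx ty cards2 xy.
rewrite /third_point; case: pickP => [u uB|/(_ t)]; last by rewrite tB.
by apply/eqP/idP => [<-//|zB]; apply: uniqT uB zB.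
Qed.

Lemma third_point_neq : steiner_triple_system -> forall x y, x != y ->
  (third_point x y != x) && (third_point x y != y).
Proof.
move=> sts x y xy; have := third_pointP sts (third_point x y) xy.
rewrite eqxx => /esym /sts.1 h; apply/andP; split; apply/eqP => tE; move: h.
- by rewrite tE setUC setUA setUid cards2; case: (x != y).
- by rewrite tE -setUA setUid cards2; case: (x != y).
Qed.

Lemma steiner_mulC : steiner_triple_system -> commutative steiner_mul.
Proof.
move=> sts [x|] [y|] //=; rewrite [y == x]eq_sym; case: eqVneq => // xy.
congr Some; apply/eqP; rewrite third_pointP // [[set x; y]]setUC.
by rewrite -third_pointP // eq_sym.
Qed.

Lemma steiner_mulK : steiner_triple_system ->
  forall x y, steiner_mul x (steiner_mul x y) = y.
Proof.
move=> sts [x|] [y|] //=; rewrite ?eqxx //; case: eqVneq => [->//|xy] /=.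
have /andP[tx ty] := third_point_neq sts xy.
rewrite eq_sym (negbTE tx); congr Some; apply/eqP.
by rewrite third_pointP 1?eq_sym // -setUA [X in _ :|: X]setUC setUA -third_pointP.
Qed.

Lemma oriented_steiner_is_loop o f : steiner_triple_system ->
  is_oriented_factor o f ->
  is_loop (oriented_steiner_mul f) oriented_steiner_one.
Proof.
move=> sts [fx0 f0x _ _]; rewrite /oriented_steiner_mul /ext_mul.
split=> [[a x]|[a x]|[a x] [b y]|[a x] [b y]] /=.
- by rewrite f0x add0r addr0.
- by rewrite fx0 !addr0; case: x.
- exists (b - a - f x (steiner_mul x y), steiner_mul x y).
  split=> [|[c z] [<- <-]] /=; rewrite steiner_mulK //.
    by rewrite -addrA subrK addrC subrK.
  by congr pair; rewrite addrAC addrK addrC addKr.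
- exists (b - a - f (steiner_mul x y) x, steiner_mul x y).
  split=> [|[c z] [<- <-]] /=; rewrite [steiner_mul _ x]steiner_mulC // steiner_mulK //.
    by rewrite addrAC subrK subrK.
  by congr pair; rewrite addrAC addrK addrK.
Qed.

End SteinerTripleSystems.

(* Main.v *)
Require Import Defs.
From mathcomp Require Import all_boot all_order all_algebra.

(** In an anti-Pasch Steiner loop L a triple (x, y, z) associates only if it is
    degenerate: some entry is the identity, two entries agree, or z = xy. Such
    a triple lies in a Klein subgroup {e, p, q, pq}, all of whose triples are
    degenerate. If squares of points are the central involution, the preimage
    of that subgroup in X is associative (for p != q it is the quaternion
    group), so associativity propagates. If points square to the identity, then
    (x, y, x) still associates for points x != y, but (x, x, y) does not. *)

Section OrientedSteinerLoops.

Set Implicit Arguments.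
Unset Strict Implicit.
Unset Printing Implicit Defensive.

Import GRing.Theory.
Local Open Scope ring_scope.

Lemma Z2_eq01 (a : 'Z_2) : a = 0 \/ a = 1.
Proof. by case: a => [[|[|//]] i]; [left|right]; apply: val_inj. Qed.

Lemma Z2_addrr (a : 'Z_2) : a + a = 0.
Proof. by case: (Z2_eq01 a) => ->; apply: val_inj. Qed.

(** * Cancellation identities in a Steiner loop *)

Variables (S : finType) (B : {set {set S}}).
Hypothesis stsB : steiner_triple_system B.

Local Notation mulL := (steiner_mul B).

Lemma steiner_mulxe x : mulL x None = x.
Proof. by case: x. Qed.

Lemma steiner_mulxx x : mulL x x = None.
Proof. by case: x => //= x; rewrite eqxx. Qed.

Lemma steiner_mulKC x y : mulL x (mulL y x) = y.
Proof. by rewrite [mulL y x]steiner_mulC // steiner_mulK. Qed.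

Lemma steiner_mulCK x y : mulL (mulL x y) x = y.
Proof. by rewrite steiner_mulC // steiner_mulK. Qed.

Lemma steiner_mulVK x y : mulL (mulL x y) y = x.
Proof. by rewrite steiner_mulC // steiner_mulKC. Qed.

Lemma steiner_mul_neq (x y : S) : x != y ->
  mulL (Some x) (Some y) = Some (third_point B x y).
Proof. by move=> /negbTE /= ->. Qed.

Lemma steiner_mulI x : injective (mulL x).
Proof. by move=> y z /(congr1 (mulL x)); rewrite !steiner_mulK. Qed.

(** * Degenerate triples and Klein subgroups *)

Definition degenerate_triple (x y z : option S) : bool :=
  [|| x == None, y == None, z == None, x == y, y == z, x == z | z == mulL x y].

(** The list may repeat: for [p = q], or with an entry [None], it is a subgroup of order at most 2.
    This lets all kinds of degenerate triples be treated alike. *)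
Definition in_klein (p q u : option S) : bool :=
  u \in [:: None; p; q; mulL p q].

Lemma in_klein_mul p q u v :
  in_klein p q u -> in_klein p q v -> in_klein p q (mulL u v).
Proof.
rewrite /in_klein !inE => /or4P[] /eqP-> /or4P[] /eqP->;
  rewrite ?steiner_mulxe ?steiner_mulxx ?steiner_mulK ?steiner_mulKC
    ?steiner_mulCK ?steiner_mulVK //= ?eqxx ?orbT //.
by rewrite [mulL q p]steiner_mulC // eqxx !orbT.
Qed.

(** Distinct non-identity elements of a Klein group are [p], [q], [pq] in some order, and each is
    the product of the other two. *)
Lemma in_klein_degenerate p q u v w :
  in_klein p q u -> in_klein p q v -> in_klein p q w -> degenerate_triple u v w.
Proof.
rewrite /in_klein /degenerate_triple !inE.
move=> /or4P[] /eqP-> /or4P[] /eqP-> /or4P[] /eqP->;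
  rewrite ?eqxx ?orbT // ?steiner_mulK ?steiner_mulKC
    ?steiner_mulCK ?steiner_mulVK ?eqxx ?orbT //.
by rewrite [mulL q p]steiner_mulC // eqxx !orbT.
Qed.

Lemma degenerate_in_klein x y z : degenerate_triple x y z ->
  exists p q, [/\ in_klein p q x, in_klein p q y & in_klein p q z].
Proof.
rewrite /degenerate_triple /in_klein.
case/or4P=> [/eqP->|/eqP->|/eqP->|/or4P[]/eqP->].
- by exists y, z; rewrite !inE !eqxx !orbT.
- by exists x, z; rewrite !inE !eqxx !orbT.
- by exists x, y; rewrite !inE !eqxx !orbT.
- by exists y, z; rewrite !inE !eqxx !orbT.
- by exists x, z; rewrite !inE !eqxx !orbT.
- by exists z, y; rewrite !inE !eqxx !orbT.
- by exists x, y; rewrite !inE !eqxx !orbT.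
Qed.

(** If a non-degenerate triple associates, with [w = x(yz) = (xy)z], then [{x, y, xy}],
    [{x, w, yz}], [{z, y, yz}], [{z, w, xy}] form a Pasch configuration. Most of the work is to show
    that its six points are distinct. *)
Lemma anti_pasch_degenerate x y z : anti_pasch B ->
  mulL x (mulL y z) = mulL (mulL x y) z -> degenerate_triple x y z.
Proof.
move=> apB; case: x y z => [x|] [y|] [z|] // xyz.
rewrite /degenerate_triple.
apply/negPn/negP; rewrite !negb_or !(inj_eq Some_inj).
move=> /and5P[_ _ _ xy /and3P[yz xz]].
rewrite steiner_mul_neq // (inj_eq Some_inj).
move: xyz; rewrite (steiner_mul_neq xy) (steiner_mul_neq yz).
set a := third_point B x y; set b := third_point B y z => xyz za.
have xyE : mulL (Some x) (Some y) = Some a by rewrite steiner_mul_neq.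
have yzE : mulL (Some y) (Some z) = Some b by rewrite steiner_mul_neq.
have /andP[ax ay] := third_point_neq stsB xy.
have /andP[yb zb] := third_point_neq stsB yz.
have xb : x != b.
  apply: contraNneq za => xb.
  by rewrite -(inj_eq Some_inj) -xyE xb steiner_mulC // -yzE steiner_mulK.
have ab : a != b.
  apply: contraNneq xz => ab.
  rewrite -(inj_eq Some_inj) -(inj_eq (@steiner_mulI (Some y))) yzE -ab.
  by rewrite steiner_mulC // xyE.
have az : a != z by rewrite eq_sym.
move: xyz; rewrite (steiner_mul_neq xb) (steiner_mul_neq az) => -[].
have xbB := third_pointP stsB (third_point B x b) xb.
have azB := third_pointP stsB (third_point B a z) az.
have xyB := third_pointP stsB a xy.
have yzB := third_pointP stsB b yz.
have xbE := steiner_mul_neq xb.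
have azE := steiner_mul_neq az.
(* [wE] is associativity. Rewriting with it gives the blocks through [x, b] and through [a, z] the
   same third point, named [w] next. *)
move: xbB azB xyB yzB xbE azE => + + + + + + wE; rewrite -wE !eqxx.
set w := third_point B x b => xbB azB xyB yzB xbE azE.
have /andP[wx wb] := third_point_neq stsB xb.
have /andP[wa wz] : (w != a) && (w != z).
  by rewrite /w wE; apply: third_point_neq.
have wy : w != y.
  apply: contraNneq xz => wy.
  rewrite -(inj_eq Some_inj) -(inj_eq (@steiner_mulI (Some y))) yzE.
  by rewrite -wy -xbE steiner_mulCK.
(* The pairs of points that share none of the four blocks are [x, z], then [y, w], then [a, b]. *)
apply: apB; exists x, y, a, w, b, z; split.
- rewrite /= !inE !negb_or xy xb xz yz ab az wb wz.
  by rewrite ![x == _]eq_sym ![y == _]eq_sym ax ay wx wy yb (eq_sym a) wa zb.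
- by rewrite -xyB.
- by rewrite setUAC -xbB.
- by rewrite [[set z; y]]setUC -yzB.
- by rewrite -setUA setUC [[set w; a]]setUC setUAC -azB.
Qed.

(** * The factor on an oriented block *)

Variables (o : {set S} -> S -> S -> S -> bool) (f : option S -> option S -> 'Z_2).
Hypothesis orient : is_orientation B o.
Hypothesis factor : is_oriented_factor B o f.

Local Notation mulX := (oriented_steiner_mul B f).

Lemma third_point_rot x y : x != y -> third_point B y (third_point B x y) = x.
Proof.
move=> xy; have /andP[_ ty] := third_point_neq stsB xy.
have yt : y != third_point B x y by rewrite eq_sym.
apply: Some_inj; rewrite -steiner_mul_neq // -steiner_mul_neq //.
by rewrite steiner_mulKC.
Qed.

Lemma factor_rot (x y : S) : x != y ->
  f (Some y) (Some (third_point B x y)) = f (Some x) (Some y).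
Proof.
move=> xy; have /andP[_ ty] := third_point_neq stsB xy.
have yt : y != third_point B x y by rewrite eq_sym.
have [_ _ fE _] := factor; rewrite !fE // /orientation_sign.
rewrite third_point_rot //; set z := third_point B x y.
have bB : [set x; y; z] \in B by rewrite -third_pointP.
have -> : [set y; z; x] = [set x; y; z] by rewrite setUC setUA.
have [rot _ _ _] := orient bB.
have xb : x \in [set x; y; z] by rewrite !inE eqxx.
have yb : y \in [set x; y; z] by rewrite !inE eqxx orbT.
have zb : z \in [set x; y; z] by rewrite !inE eqxx !orbT.
suff -> : o [set x; y; z] y z x = o [set x; y; z] x y z by [].
by apply/idP/idP => [/(rot _ _ _ yb zb xb)/(rot _ _ _ zb xb yb)|/(rot _ _ _ xb yb zb)].
Qed.

(** The order [y, x, z] is a rotation of [z, y, x], and by asymmetry and totality exactly one of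
    [x, y, z] and [z, y, x] agrees with the orientation. *)
Lemma factor_flip (x y : S) : x != y ->
  f (Some y) (Some x) = f (Some x) (Some y) + 1.
Proof.
move=> xy; have /andP[tx ty] := third_point_neq stsB xy.
have yx : y != x by rewrite eq_sym.
have [_ _ fE _] := factor; rewrite !fE // /orientation_sign.
have -> : third_point B y x = third_point B x y.
  apply: Some_inj; rewrite -!steiner_mul_neq //.
  exact: steiner_mulC.
set z := third_point B x y.
have bB : [set x; y; z] \in B by rewrite -third_pointP.
have -> : [set y; x; z] = [set x; y; z] by rewrite [[set y; x]]setUC.
have [rot asym _ tot] := orient bB.
have xb : x \in [set x; y; z] by rewrite !inE eqxx.
have yb : y \in [set x; y; z] by rewrite !inE eqxx orbT.
have zb : z \in [set x; y; z] by rewrite !inE eqxx !orbT.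
have xyz_uniq : uniq [:: x; y; z].
  by rewrite /= !inE negb_or xy !(eq_sym _ z) tx ty.
have -> : o [set x; y; z] y x z = ~~ o [set x; y; z] x y z.
  have -> : o [set x; y; z] y x z = o [set x; y; z] z y x.
    by apply/idP/idP => [/(rot _ _ _ yb xb zb)/(rot _ _ _ xb zb yb)
                        |/(rot _ _ _ zb yb xb)].
  have := tot _ _ _ xb yb zb xyz_uniq; have := asym _ _ _ xb yb zb.
  by case: (o _ x y z) => [/(_ isT)/negbTE|_].
by case: (o _ x y z); rewrite ?add0r ?Z2_addrr.
Qed.

(** The 2-cocycle condition of group extensions, asked at a single triple because a Steiner loop
    need not be associative elsewhere. *)
Definition cocycle_at (x y z : option S) : Prop :=
  f y z + f x (mulL y z) = f x y + f (mulL x y) z.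

Lemma mulX_assoc x y z :
  mulL x.2 (mulL y.2 z.2) = mulL (mulL x.2 y.2) z.2 ->
  cocycle_at x.2 y.2 z.2 -> mulX x (mulX y z) = mulX (mulX x y) z.
Proof.
case: x y z => [a x] [b y] [c z] /= xyz fxyz.
rewrite /oriented_steiner_mul /ext_mul /= xyz; congr pair.
by rewrite -!addrA; do 2!congr (_ + _); rewrite fxyz addrCA.
Qed.

Lemma factor_diag (x y : S) : f (Some x) (Some x) = f (Some y) (Some y).
Proof. by have [_ _ _] := factor. Qed.

Lemma factorx0 x : f x None = 0.
Proof. by have [] := factor. Qed.

Lemma factor0x x : f None x = 0.
Proof. by have [] := factor. Qed.

(** One bit [t] fixes [f] on all six ordered pairs of a block, so the cocycle conditions below
    become sums of [t] and [t + 1]. *)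
Lemma factor_block (x y : S) (t := f (Some x) (Some y)) : x != y ->
  exists z, [/\ mulL (Some x) (Some y) = Some z,
    f (Some y) (Some z) = t, f (Some z) (Some x) = t
    & [/\ f (Some y) (Some x) = t + 1, f (Some z) (Some y) = t + 1
        & f (Some x) (Some z) = t + 1]].
Proof.
move=> xy; have /andP[tx ty] := third_point_neq stsB xy.
have yt : y != third_point B x y by rewrite eq_sym.
exists (third_point B x y).
have zx := factor_rot yt; rewrite third_point_rot // factor_rot // in zx.
split; rewrite ?steiner_mul_neq ?factor_rot //.
by split; rewrite factor_flip ?factor_rot ?zx.
Qed.

Lemma cocycle_flexible x y : cocycle_at x y x.
Proof.
rewrite /cocycle_at; case: x y => [x|] [y|]; last 3 first.
- by rewrite steiner_mulxe factorx0 factor0x.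
- by rewrite steiner_mulxe !factorx0 !factor0x.
- by [].
have [->|xy] := eqVneq x y; first by rewrite steiner_mulxx factorx0 factor0x.
have [z [xyz _ zx [yx _ xz]]] := factor_block xy.
by rewrite [mulL (Some y) _]steiner_mulC // xyz zx yx xz !Z2_addrr.
Qed.

(** The two sides contain the squares of [x] and of [xy], which balance because [f] is constant on
    the diagonal of points. *)
Lemma cocycle_mul x y : cocycle_at x y (mulL x y).
Proof.
rewrite /cocycle_at steiner_mulKC; case: x y => [x|] [y|]; last 3 first.
- by rewrite steiner_mulxe factorx0 factor0x.
- by rewrite /= !factor0x addrC.
- by [].
have [->|xy] := eqVneq x y; first by rewrite steiner_mulxx !factorx0 addrC.
by have [z [-> -> _ _]] := factor_block xy; rewrite (factor_diag x z).
Qed.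

(** * Propagation when points square to the central involution *)

Section SquareOne.

Hypothesis sq1 : forall x, f (Some x) (Some x) = 1.

(** For distinct points the condition reads [t + (t + 1) = f x x], so it holds exactly because the
    diagonal value is 1. *)
Lemma cocycle_left x y : cocycle_at x x y.
Proof.
rewrite /cocycle_at steiner_mulxx factor0x addr0; case: x y => [x|] [y|]; last 3 first.
- by rewrite steiner_mulxe factorx0 add0r.
- by rewrite !factor0x addr0.
- by rewrite !factor0x addr0.
have [->|xy] := eqVneq x y; first by rewrite steiner_mulxx factorx0 addr0.
have [z [-> _ _ [_ _ ->]]] := factor_block xy.
by rewrite addrA Z2_addrr add0r sq1.
Qed.

Lemma cocycle_right x y : cocycle_at x y y.
Proof.
rewrite /cocycle_at steiner_mulxx factorx0 addr0; case: x y => [x|] [y|]; last 3 first.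
- by rewrite !factorx0 addr0.
- by rewrite factor0x add0r.
- by rewrite !factorx0 addr0.
have [->|xy] := eqVneq x y; first by rewrite steiner_mulxx factor0x addr0.
have [z [-> _ _ [_ -> _]]] := factor_block xy.
by rewrite addrA Z2_addrr add0r sq1.
Qed.

Lemma degenerate_assoc x y z : degenerate_triple x.2 y.2 z.2 ->
  mulX x (mulX y z) = mulX (mulX x y) z.
Proof.
rewrite /degenerate_triple => xyz; apply: mulX_assoc; move: xyz.
  case/or4P=> [/eqP->|/eqP->|/eqP->|/or4P[]/eqP->].
  - by [].
  - by rewrite steiner_mulxe.
  - by rewrite !steiner_mulxe.
  - by rewrite steiner_mulxx steiner_mulK.
  - by rewrite steiner_mulVK steiner_mulxx steiner_mulxe.
  - by rewrite steiner_mulKC steiner_mulCK.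
  - by rewrite steiner_mulKC !steiner_mulxx.
case/or4P=> [/eqP->|/eqP->|/eqP->|/or4P[]/eqP->].
- by rewrite /cocycle_at !factor0x addrC.
- by rewrite /cocycle_at steiner_mulxe factorx0 factor0x.
- by rewrite /cocycle_at steiner_mulxe !factorx0 addrC.
- exact: cocycle_left.
- exact: cocycle_right.
- exact: cocycle_flexible.
- exact: cocycle_mul.
Qed.

Lemma square_one_propagates : anti_pasch B ->
  associativity_propagates mulX (oriented_steiner_one S).
Proof.
move=> apB x y z xyz u v w uX vX wX.
have [p [q [xK yK zK]]] : exists p q,
    [/\ in_klein p q x.2, in_klein p q y.2 & in_klein p q z.2].
  by apply: degenerate_in_klein; apply: anti_pasch_degenerate apB (congr1 snd xyz).
have Ksub : is_subloop mulX (oriented_steiner_one S)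
    (fun t : 'Z_2 * option S => in_klein p q t.2).
  split=> [|s t|s t sK stK|s t tK stK]; first by rewrite /in_klein inE.
  - exact: in_klein_mul.
  (* Elements of a Steiner loop are their own inverses, so division is again multiplication and
     stays in the Klein subgroup. *)
  - by rewrite -(steiner_mulK stsB s.2 t.2); apply: in_klein_mul.
  - by rewrite -(steiner_mulVK s.2 t.2); apply: in_klein_mul.
apply: degenerate_assoc.
by apply: in_klein_degenerate (uX _ Ksub _ _ _) (vX _ Ksub _ _ _) (wX _ Ksub _ _ _).
Qed.

End SquareOne.

(** * Propagation forces the diagonal value 1 *)

Lemma propagates_square_one x y : x != y ->
  associativity_propagates mulX (oriented_steiner_one S) ->
  f (Some x) (Some x) = 1.
Proof.
move=> xy prop.
have xyx : mulX (0, Some x) (mulX (0, Some y) (0, Some x))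
           = mulX (mulX (0, Some x) (0, Some y)) (0, Some x).
  apply: mulX_assoc; last exact: cocycle_flexible.
  by rewrite steiner_mulKC steiner_mulCK.
(* Propagation carries associativity from [(x, y, x)] to [(x, x, y)], whose first coordinates give
   [t + (t + 1) = f x x]. *)
have /(congr1 fst) := prop _ _ _ xyx (0, Some x) (0, Some x) (0, Some y)
  (fun H _ hx _ _ => hx) (fun H _ hx _ _ => hx) (fun H _ _ hy _ => hy).
rewrite /= eqxx (negbTE xy) factor0x -steiner_mul_neq //.
have [z [-> _ _ [_ _ ->]]] := factor_block xy.
by rewrite !(add0r, addr0) addrA Z2_addrr add0r => <-.
Qed.

(** * Powers and the exponent *)

Lemma is_power_point a x n y : is_power mulX (a, Some x) n y ->
  y = (a *+ n + f (Some x) (Some x) *+ n./2, if odd n then Some x else None).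
Proof.
elim=> [|m k _ _ _ -> _ ->]; first by rewrite addr0.
(* Only when [m] and [k] are both odd does the product contribute [f x x], and only then does
   [(m + k)./2] exceed [m./2 + k./2], by one. *)
rewrite /oriented_steiner_mul /ext_mul /= oddD halfD mulrnDr [in RHS]mulrnDr.
rewrite mulrnDr addrACA; case: (odd m); case: (odd k) => /=;
  rewrite ?eqxx ?factorx0 ?factor0x ?mulr0n ?add0r ?addr0 // -!addrA.
by congr pair; do 2!congr (_ + _); rewrite mulr1n addrA addrC.
Qed.

Lemma is_power_center a n y : is_power mulX (a, None) n y -> y = (a *+ n, None).
Proof.
elim=> [//|m k _ _ _ -> _ ->].
by rewrite /oriented_steiner_mul /ext_mul /= factorx0 addr0 mulrnDr.
Qed.

Lemma exponent4_square_one x :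
  has_exponent mulX (oriented_steiner_one S) 4 <-> f (Some x) (Some x) = 1.
Proof.
split=> [[_ _ /(_ 2 isT) not2]|sq1].
  case: (Z2_eq01 (f (Some x) (Some x))) => // sq0; case: not2.
  move=> [a [s|]] y; last by move=> /is_power_center ->; rewrite mulr2n Z2_addrr.
  by move=> /is_power_point ->; rewrite (factor_diag s x) sq0 mulr2n Z2_addrr addr0.
(* Smaller exponents fail at [(0, Some x)]: its first and third powers lie over [x], and its square
   is [(1, None)]. *)
split=> // [[a [s|]] y|[//|[|[|[|//]]]] _ expm].
- move=> /is_power_point ->.
  by rewrite (factor_diag s x) mulr2n Z2_addrr (mulrnDr a 2 2) Z2_addrr addr0.
- by move=> /is_power_center ->; rewrite (mulrnDr a 2 2) Z2_addrr.
- by have := expm (0, Some x) _ (is_power1 _ _).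
- have := expm (0, Some x) _ (is_powerM (is_power1 mulX _) (is_power1 _ _)).
  by rewrite /oriented_steiner_mul /ext_mul /= eqxx sq1 => -[].
- have := expm (0, Some x) _ (is_powerM (is_power1 _ _)
    (is_powerM (is_power1 mulX _) (is_power1 _ _))).
  by rewrite /oriented_steiner_mul /ext_mul /= eqxx.
Qed.

End OrientedSteinerLoops.

Theorem theorem6p8 (S : finType) (B : {set {set S}})
    (o : {set S} -> S -> S -> S -> bool)
    (f : option S -> option S -> 'Z_2)
    (cardS : (1 < #|S|)%N)
    (stsB : steiner_triple_system B)
    (apB : anti_pasch B)
    (orient : is_orientation B o)
    (factor : is_oriented_factor B o f) :
  associativity_propagates (oriented_steiner_mul B f) (oriented_steiner_one S)
  <-> has_exponent (oriented_steiner_mul B f) (oriented_steiner_one S) 4.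
Proof.
(* Two distinct points supply the test triples [(x, y, x)] and [(x, x, y)]. *)
have /card_gt1P[x [y [_ _ xy]]] := cardS.
split=> [prop|exp4].
  apply/(exponent4_square_one factor x).
  exact: (propagates_square_one stsB orient factor xy prop).
have sq1 := (exponent4_square_one factor x).1 exp4.
apply: (square_one_propagates stsB orient factor _ apB) => s.
by rewrite (factor_diag factor s x).
Qed.
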